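(* Let $\mathcal S=\{D_1,\dots,D_m\}\subset\mathbb C^{d\times d}$ be a family of diagonal matrices $D_i=\operatorname{diag}(\lambda^{(i)}_1,\dots,\lambda^{(i)}_d)$ with all $\lambda_j^{(i)}\neq 0$, with probability weights $p_1,\dots,p_m$, and suppose that $|\lambda_1^{(i)}|>\max_{r\ne 1}|\lambda_r^{(i)}|$ for every $i=1,\dots,m$. Then the random spectral radius $\rho_n(\mathcal S,\mathbb P_{\mathcal S})$ of length $n$ satisfies $$\rho_n(\mathcal S,\mathbb P_{\mathcal S})\xrightarrow{\text{a.s.}}\rho_\infty(\mathcal S,\mathbb P_{\mathcal S}):=\prod_{i=1}^m|\lambda_1^{(i)}|^{p_i}\qquad\text{as } n\to\infty,$$ i.e. $\mathbb P\bigl(\lim_{n\to\infty}\rho_n(\mathcal S,\mathbb P_{\mathcal S})=\rho_\infty(\mathcal S,\mathbb P_{\mathcal S})\bigr)=1$.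
   Context: $\mathbb P_{\mathcal S}$ assigns mass $p_i\ge 0$ to $D_i$, with $\sum_i p_i=1$. Let $(i_k)_{k\ge1}$ be i.i.d. random indices in $\{1,\dots,m\}$ with $\mathbb P(i_k=i)=p_i$. The random spectral radius of length $n$ is the random variable $\rho_n(\mathcal S,\mathbb P_{\mathcal S}):=\rho(D_{i_n}\cdots D_{i_1})^{1/n}$, where $\rho(\cdot)$ is the spectral radius of a matrix. *)

(* Defs.v *)
From HB Require Import structures.
From mathcomp Require Export all_boot all_order all_algebra finmap complex.
From mathcomp Require Export all_classical all_reals all_analysis.
Export Order.TTheory GRing.Theory Num.Theory.
Export numFieldNormedType.Exports.

Set Implicit Arguments.
Unset Strict Implicit.
Unset Printing Implicit Defensive.

Local Open Scope classical_set_scope.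
Local Open Scope ring_scope.

(* The modulus of a complex number as an element of R (the norm `|z| lives
   in R[i]). *)
Notation modulus := ComplexField.Normc.normc.

(* [eigenvalue] refers to row eigenvectors, which does not change the spectrum
   of a square matrix.  For d > 0 the set below is finite and nonempty, so that
   its supremum is a maximum. *)
Definition spectral_radius (R : realType) (d : nat) (A : 'M[R[i]]_d) : R :=
  sup [set modulus a | a in [set a : R[i] | eigenvalue A a]].

(* Indices start at 0: [X k] is the (k+1)-st random index, and
   [left_product D x n] is D_(x (n-1)) *m ... *m D_(x 0). *)
Fixpoint left_product (R : realType) (d m : nat) (D : 'I_m -> 'M[R[i]]_d)
    (x : nat -> 'I_m) (n : nat) : 'M[R[i]]_d :=
  if n is k.+1 then D (x k) *m left_product D x k else 1%:M.

(* At n = 0 the exponent n%:R^-1 is 0; this value plays no role in limits. *)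
Definition random_spectral_radius (R : realType) (d m : nat) (T : Type)
    (D : 'I_m -> 'M[R[i]]_d) (X : nat -> T -> 'I_m) (n : nat) (w : T) : R :=
  spectral_radius (left_product D (fun k => X k w) n) `^ (n%:R^-1).

(* Measurability is with respect to the discrete sigma-algebra on 'I_m. *)
Definition random_indices (disp : measure_display) (T : measurableType disp)
    (m : nat) (X : nat -> T -> 'I_m) : Prop :=
  forall (k : nat) (B : set 'I_m), measurable (X k @^-1` B).

Definition mutually_independent (disp : measure_display)
    (T : measurableType disp) (R : realType) (P : probability T R) (m : nat)
    (X : nat -> T -> 'I_m) : Prop :=
  forall (J : {fset nat}) (B : nat -> set 'I_m),
    P (\bigcap_(k in [set` J]) (X k @^-1` B k))
    = (\prod_(k <- J) P (X k @^-1` B k))%E.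

Definition iid_indices (disp : measure_display) (T : measurableType disp)
    (R : realType) (P : probability T R) (m : nat) (p : 'I_m -> R)
    (X : nat -> T -> 'I_m) : Prop :=
  [/\ random_indices X,
      mutually_independent P X &
      forall (k : nat) (i : 'I_m), P (X k @^-1` [set i]) = (p i)%:E].

(* Main.v *)
(** For diagonal matrices with a dominant first entry the spectral radius of a
    product is the product of the moduli of the first entries, so that
    [ln rho_n] is the empirical mean of the i.i.d. bounded variables
    [ln |lambda_1^(i_k)|], and the claim is the strong law of large numbers.
    The latter only needs pairwise uncorrelated bounded variables: the second
    moment of the centred partial sum [S_n] is [O(n)], so the sum over [n] of
    [(S_(n^2) / n^2) ^ 2] has finite expectation and is almost surely finite;
    this gives convergence along the squares, and boundedness fills the gaps. *)

Require Import Defs.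
From mathcomp Require Import measurable_realfun ring lra zify.

Local Open Scope classical_set_scope.
Local Open Scope ring_scope.

(** * Spectral radius of products of diagonal matrices *)

Lemma sup_eq_max (R : realType) (A : set R) (x : R) :
  A x -> ubound A x -> sup A = x.
Proof.
move=> Ax Aub; apply/eqP; rewrite eq_le ge_sup//=; last by exists x.
by apply: ub_le_sup => //; exists x.
Qed.

Lemma eigenvalue_diag_mx (F : fieldType) (n : nat) (v : 'rV[F]_n) (a : F) :
  eigenvalue (diag_mx v) a = [exists r, a == v ord0 r].
Proof.
rewrite eigenvalue_root_char char_poly_trig ?diag_mx_is_trig//.
rewrite rootE horner_prod; apply/prodf_eq0/existsP => -[r].
  by move=> _; rewrite hornerXsubC mxE eqxx subr_eq0; exists r.
by move=> ar; exists r => //; rewrite hornerXsubC mxE eqxx subr_eq0.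
Qed.

Lemma spectral_radius_diag_mx (R : realType) (d : nat) (v : 'rV[R[i]]_d)
    (r0 : 'I_d) :
    (forall r, modulus (v ord0 r) <= modulus (v ord0 r0)) ->
  spectral_radius (diag_mx v) = modulus (v ord0 r0).
Proof.
move=> vmax; apply: sup_eq_max.
  exists (v ord0 r0) => //=; rewrite eigenvalue_diag_mx.
  by apply/existsP; exists r0.
by move=> _ [a /= + <-]; rewrite eigenvalue_diag_mx => /existsP[r /eqP ->].
Qed.

Lemma left_product_diag_mx (R : realType) (d m : nat)
    (lambda : 'I_m -> 'I_d -> R[i]) (x : nat -> 'I_m) (n : nat) :
  left_product (fun i => diag_mx (\row_r lambda i r)) x n =
  diag_mx (\row_r \prod_(k < n) lambda (x k) r).
Proof.
elim: n => [|n IHn] /=; apply/matrixP => i j.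
  by rewrite !mxE big_ord0.
rewrite IHn mulmx_diag; congr (diag_mx _ _ _); apply/rowP => r.
by rewrite !mxE big_ord_recr mulrC.
Qed.

Lemma modulus_prod (R : realType) (I : Type) (s : seq I) (F : I -> R[i]) :
  modulus (\prod_(k <- s) F k) = \prod_(k <- s) modulus (F k).
Proof.
by apply: big_morph; [exact: ComplexField.Normc.normcM
                     |exact: ComplexField.Normc.normc1].
Qed.

Lemma modulus_ge0 (R : realType) (z : R[i]) : 0 <= modulus z.
Proof. by case: z => a b; exact: sqrtr_ge0. Qed.

Lemma modulus_gt0 (R : realType) (z : R[i]) : z != 0 -> 0 < modulus z.
Proof.
rewrite lt0r modulus_ge0 andbT; apply: contraNneq.
by move=> /ComplexField.Normc.eq0_normc ->.
Qed.

(** The same index [r0] dominates in every factor, and inequalities between nonnegative moduli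
    multiply, so [r0] also dominates in the product. *)
Lemma random_spectral_radius_diag_mx (R : realType) (d m : nat) (T : Type)
    (lambda : 'I_m -> 'I_d -> R[i]) (r0 : 'I_d) (X : nat -> T -> 'I_m)
    (n : nat) (w : T) :
    (forall i r, modulus (lambda i r) <= modulus (lambda i r0)) ->
  random_spectral_radius (fun i => diag_mx (\row_r lambda i r)) X n w =
  (\prod_(k < n) modulus (lambda (X k w) r0)) `^ (n%:R^-1).
Proof.
move=> dom; rewrite /random_spectral_radius left_product_diag_mx.
rewrite (@spectral_radius_diag_mx _ _ _ r0) ?mxE ?modulus_prod// => r.
rewrite !mxE !modulus_prod; apply: ler_prod => k _.
by rewrite modulus_ge0 dom.
Qed.

(** Passage from products to sums of logarithms. It serves twice: with the weights [p] for the
    limit, and with exponent 1 for the finite products. *)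
Lemma prod_expR_ln (R : realType) (I : Type) (s : seq I) (F q : I -> R) :
    (forall i, 0 < F i) ->
  \prod_(i <- s) F i `^ q i = expR (\sum_(i <- s) ln (F i) * q i).
Proof.
move=> F0; rewrite (big_morph expR (@expRD _) (@expR0 _)).
by apply: eq_bigr => i _; rewrite /powR gt_eqF// mulrC.
Qed.

(** * Means along squares, and a bound on the sum of inverse squares *)

Lemma exists_square_bracket (n : nat) : (0 < n)%N ->
  exists k, (k.+1 ^ 2 <= n < k.+2 ^ 2)%N.
Proof.
elim: n => // -[_ _|n /(_ isT)[k /andP[kn nk]] _]; first by exists 0%N.
have [nk'|nk'] := ltnP n.+2 (k.+2 ^ 2).
  by exists k; rewrite nk' andbT; apply: leq_trans kn _.
by exists k.+1; rewrite nk'/=; move: nk nk'; rewrite !expnS !expn0; lia.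
Qed.

Lemma sum_ord_split (R : realType) (y : nat -> R) (q n : nat) : (q <= n)%N ->
  \sum_(k < n) y k = \sum_(k < q) y k + \sum_(q <= k < n) y k.
Proof. by move=> qn; rewrite -!(big_mkord xpredT y) (big_cat_nat (leq0n q) qn). Qed.

(* Along [k.+1 ^ 2 <= n < k.+2 ^ 2] the partial sums move by at most
   [2 * k.+1 * C], which is negligible with respect to [n]. *)
Lemma cvg_mean_squares (R : realType) (y : nat -> R) (C : R) :
    (forall k, `|y k| <= C) ->
    (\sum_(k < n.+1 ^ 2) y k) / (n.+1 ^ 2)%:R @[n --> \oo] --> 0 ->
  (\sum_(k < n) y k) / n%:R @[n --> \oo] --> 0.
Proof.
move=> yC sq0.
(* The second term bounds the tail after the square: at most [2 * k.+1] summands of size at most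
   [C], divided by at least [k.+1 ^ 2]; [harmonic k] is [k.+1%:R^-1]. *)
pose v k := `|(\sum_(i < k.+1 ^ 2) y i) / (k.+1 ^ 2)%:R| + C * 2 * harmonic k.
have v0 : v k @[k --> \oo] --> 0.
  rewrite -[0]addr0; apply: cvgD.
    by have := cvg_norm sq0; rewrite normr0; apply; exact: eventually_filter.
  by rewrite -(mulr0 (C * 2)); apply: cvgM; [exact: cvg_cst|exact: cvg_harmonic].
have C0 : 0 <= C by rewrite (le_trans _ (yC 0%N)).
apply/cvgr0Pnorm_lt => e e0.
move/cvgr0Pnorm_lt : v0 => /(_ _ e0)[K _ vK].
(* Beyond this threshold the bracket index [k] of [n] is at least [K]. *)
exists (K.+1 ^ 2)%N => // n /= Kn.
have n0 : (0 < n)%N by rewrite (leq_trans _ Kn)// expn_gt0.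
have [k /andP[kn nk]] := exists_square_bracket n n0.
have Kk : (K <= k)%N by move: (leq_ltn_trans Kn nk); rewrite ltn_sqr.
have /= := vK k Kk; apply: le_lt_trans; rewrite [leRHS]ger0_norm; last first.
  by rewrite /v addr_ge0// !mulr_ge0// harmonic_ge0.
have nR : 0 < n%:R :> R by rewrite ltr0n.
rewrite /= (sum_ord_split _ y _ _ kn) mulrDl (le_trans (ler_normD _ _))// lerD//.
  rewrite !normrM ler_wpM2l// !ger0_norm ?invr_ge0//.
  by rewrite lef_pV2 ?posrE ?ltr0n ?expn_gt0// ler_nat.
rewrite normrM [X in _ * X]ger0_norm ?invr_ge0// ler_pdivrMr//.
apply: le_trans (ler_norm_sum _ _ _) _.
apply: le_trans (ler_sum _ (fun i _ => yC i)) _.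
rewrite sumr_const_nat -[leLHS]mulr_natr -2!mulrA ler_wpM2l//.
(* With [C] cancelled, an inequality in [nat] remains: [(n - k.+1 ^ 2) * k.+1 <= 2 * n]. *)
rewrite mulrAC ler_pdivlMr ?ltr0n// -!natrM ler_nat.
by move: kn nk; rewrite !expnS !expn0; nia.
Qed.

Lemma sum_inv_square_le (R : realType) (n : nat) :
  \sum_(k < n) (k.+1 ^ 2)%:R^-1 <= 2 :> R.
Proof.
(* The bound is strengthened so that induction applies: [1 / x ^ 2 <= 2 / x - 2 / (x + 1)] for
   [x >= 1], and the right-hand sides telescope. *)
suff : \sum_(k < n) (k.+1 ^ 2)%:R^-1 <= 2 - 2 / n.+1%:R :> R.
  by move=> /le_trans; apply; rewrite gerBl.
elim: n => [|n IHn]; first by rewrite big_ord0 divr1 subrr.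
rewrite big_ord_recr/= (le_trans (lerD IHn (lexx _)))// natrX.
have -> : n.+2%:R = n.+1%:R + 1 :> R by rewrite natr1.
have : 1 <= n.+1%:R :> R by rewrite ler1n.
move: n.+1%:R => x x1; have x0 : 0 < x by lra.
rewrite -subr_ge0 (_ : _ - _ = (x - 1) / (x ^+ 2 * (x + 1))); last first.
  by field; rewrite !gt_eqF//; lra.
by rewrite divr_ge0 ?mulr_ge0 ?sqr_ge0//; lra.
Qed.

(** * Strong law for bounded, pairwise uncorrelated variables *)

Section PairwiseUncorrelated.
Context d (T : measurableType d) (R : realType) (P : probability T R).
Variables (Y : nat -> T -> R) (C : R).
Hypothesis mY : forall k, measurable_fun setT (Y k).
Hypothesis YC : forall k w, `|Y k w| <= C.
Hypothesis uncorrelated : forall k l, k != l ->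
  (\int[P]_w (Y k w * Y l w)%:E = 0)%E.

Lemma bounded_integrable (f : T -> R) (M : R) : measurable_fun setT f ->
  (forall w, `|f w| <= M) -> P.-integrable setT (EFin \o f).
Proof.
move=> mf fM; apply: measurable_bounded_integrable => //.
  by rewrite (le_lt_trans (probability_le1 P measurableT)) ?ltry.
exists M; split => [|N MN w _ /=]; first exact: num_real.
exact: le_trans (fM w) (ltW MN).
Qed.

(** In the expanded square the off-diagonal terms integrate to 0, and each of the [n] diagonal terms
    contributes at most [C ^ 2]. *)
Lemma second_moment_le (n : nat) :
  (\int[P]_w ((\sum_(k < n) Y k w) ^+ 2)%:E <= (n%:R * C ^+ 2)%:E)%E.
Proof.
have C2 k l w : `|Y k w * Y l w| <= C ^+ 2.
  by rewrite normrM expr2 ler_pM.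
have iY k l : P.-integrable setT (EFin \o (fun w => Y k w * Y l w)).
  by apply: bounded_integrable (C2 k l); exact: measurable_funM.
under eq_integral => w _.
  rewrite expr2 big_distrlr/= -sumEFin.
  under eq_bigr do rewrite -sumEFin.
  over.
rewrite integral_sum//; last first.
  by move=> k; apply: integrable_sum => // l _; exact: iY.
have -> : n%:R * C ^+ 2 = \sum_(k < n) C ^+ 2.
  by rewrite sumr_const card_ord mulr_natl.
rewrite -sumEFin; apply: lee_sum => k _.
rewrite integral_sum//=; first last.
  by move=> l; exact: iY.
rewrite (bigD1 k)//= big1 ?adde0; last first.
  by move=> l lk; rewrite uncorrelated// eq_sym.
rewrite (@le_trans _ _ (\int[P]_w (C ^+ 2)%:E)%E)//; last first.
  by rewrite integral_cst//= probability_setT mule1.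
apply: le_integral => //.
- exact: iY.
- exact: finite_measure_integrable_cst.
- by move=> w _; rewrite lee_fin (le_trans (ler_norm _)).
Qed.

Lemma strong_law_squares :
  {ae P, forall w, (\sum_(k < n.+1 ^ 2) Y k w) / (n.+1 ^ 2)%:R @[n --> \oo] --> 0}.
Proof.
pose u n w := ((\sum_(k < n.+1 ^ 2) Y k w) / (n.+1 ^ 2)%:R) ^+ 2.
have u0 n w : 0 <= u n w by exact: sqr_ge0.
have mS n : measurable_fun setT (fun w => \sum_(k < n) Y k w).
  exact: measurable_sum.
have mu n : measurable_fun setT (u n).
  by apply: measurable_funX; apply: measurable_funM.
(* With [q = n.+1 ^ 2], the second moment [q * C ^ 2] cancels one factor of [q ^ 2], which leaves a
   summable bound. *)
have int_u n : (\int[P]_w (u n w)%:E <= (C ^+ 2 * (n.+1 ^ 2)%:R^-1)%:E)%E.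
  rewrite /u; set q := (n.+1 ^ 2)%N.
  have q0 : 0 < q%:R :> R by rewrite ltr0n expn_gt0.
  under eq_integral do rewrite exprMn mulrC EFinM.
  rewrite ge0_integralZl//; last 2 first.
  - by apply: measurableT_comp => //; apply: measurable_funX.
  - by move=> w _; rewrite lee_fin sqr_ge0.
  apply: le_trans (lee_wpmul2l _ (second_moment_le q)) _.
    by rewrite lee_fin sqr_ge0.
  rewrite -EFinM lee_fin le_eqVlt; apply/predU1P; left.
  by field; rewrite gt_eqF.
have : (\int[P]_w (\sum_(n <oo) (u n w)%:E) < +oo)%E.
  rewrite integral_nneseries//; last 2 first.
  - by move=> n; exact/measurable_EFinP.
  - by move=> n w _; rewrite lee_fin.
  apply: (@le_lt_trans _ _ (C ^+ 2 * 2)%:E); last exact: ltry.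
  apply: lime_le.
    by apply: is_cvg_nneseries => n _ _; apply: integral_ge0 => w _; rewrite lee_fin.
  apply: nearW => n.
  apply: le_trans (lee_sum _ (fun k _ => int_u k)) _.
  rewrite sumEFin lee_fin -mulr_sumr ler_wpM2l ?sqr_ge0//.
  by rewrite big_mkord sum_inv_square_le.
move=> fin.
have : P.-integrable setT (fun w => \sum_(n <oo) (u n w)%:E)%E.
  apply/integrableP; split.
    by apply: ge0_emeasurable_sum => [n w _ _|n _];
      [rewrite lee_fin|exact/measurable_EFinP].
  under eq_integral => w _.
    rewrite gee0_abs ?nneseries_ge0//; last by move=> n _ _; rewrite lee_fin.
    over.
  exact: fin.
(* An integrable function is finite almost everywhere; where the series of the nonnegative [u n w]
   is finite, its terms tend to 0. *)
move=> /(integrable_ae measurableT); apply: filterS => w /(_ I) uw.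
have : summable xpredT (fun n => (u n w)%:E).
  rewrite /summable -nneseries_esum//.
  under eq_eseriesr do rewrite gee0_abs ?lee_fin//.
  by rewrite ltey_eq uw.
move=> /summable_cvg => /(_ (fun n _ => u0 n w)) /cvg_series_cvg_0.
move=> /cvgr0Pnorm_lt uw0; apply/cvgr0Pnorm_lt => e e0.
(* Since [u n w] is a square, the threshold [e ^ 2] for it gives [e] for the mean itself. *)
apply: filterS (uw0 _ (exprn_gt0 2 e0)) => n /=.
by rewrite /u normrX ltr_pXn2r ?nnegrE// ltW.
Qed.

Lemma strong_law_uncorrelated :
  {ae P, forall w, (\sum_(k < n) Y k w) / n%:R @[n --> \oo] --> 0}.
Proof.
apply: filterS strong_law_squares => w.
exact: (cvg_mean_squares _ (Y ^~ w) C (fun k => YC k w)).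
Qed.

End PairwiseUncorrelated.

(** Convergence to [c] means that the upper limit of the distances to [c] is 0. Taken in the
    extended reals, this upper limit is defined everywhere and measurable. *)
Lemma measurable_cvgr d (T : measurableType d) (R : realType)
    (f : nat -> T -> R) (c : R) :
  (forall n, measurable_fun setT (f n)) ->
  measurable [set w | f n w @[n --> \oo] --> c].
Proof.
move=> mf; pose g n w : \bar R := `|f n w - c|%:E.
have mg : measurable_fun setT (fun w => limn_esup (g ^~ w)).
  apply: measurable_fun_limn_esup => n; apply/measurable_EFinP.
  by apply: measurableT_comp => //; exact: measurable_funB.
suff -> : [set w | f n w @[n --> \oo] --> c] =
    (fun w => limn_esup (g ^~ w)) @^-1` [set 0%E].
  by rewrite -[X in measurable X]setTI; exact: mg.
apply/seteqP; split => w /= fw.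
  apply: (cvg_limn_einf_sup _).2; apply: cvg_EFin; first exact: nearW.
  by apply/norm_cvg0P/subr_cvg0.
apply/subr_cvg0; apply/norm_cvg0P.
have /fine_cvgP[] : g n w @[n --> \oo] --> 0%:E; last by [].
apply: limn_esup_le_cvg; first by rewrite fw.
by move=> n; rewrite lee_fin.
Qed.

(** * Strong law for functions of the i.i.d. indices *)

Section IidIndices.
Context d (T : measurableType d) (R : realType) (P : probability T R).
Variables (m : nat) (p : 'I_m -> R) (X : nat -> T -> 'I_m).
Hypothesis hX : iid_indices P p X.

Lemma measurable_comp_index (g : 'I_m -> R) k :
  measurable_fun setT (fun w => g (X k w)).
Proof. by case: hX => mX _ _ _ B _; rewrite setTI; exact: mX (g @^-1` B). Qed.

Lemma probability_two_indices k l i j : k != l ->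
  P (X k @^-1` [set i] `&` X l @^-1` [set j]) = (p i * p j)%:E.
Proof.
case: hX => _ indep law kl.
pose B n : set 'I_m := if n == k then [set i] else [set j].
have := indep [fset k; l]%fset B.
rewrite big_fsetU1 ?inE//= big_seq_fset1 /B eqxx eq_sym (negPf kl) !law EFinM => <-.
congr (P _); apply/seteqP; split => w /=.
  move=> [wi wj] n; rewrite /= !inE => /orP[]/eqP->; rewrite ?eqxx //.
  by rewrite eq_sym (negPf kl).
move=> H; split.
  by have := H k; rewrite /= !inE !eqxx/=; exact.
by have := H l; rewrite /= !inE !eqxx/= orbT eq_sym (negPf kl); exact.
Qed.

(** The product is a finite combination of indicators of the events that fix both indices;
    independence factors their probabilities, so the double sum becomes a square. For centred [g]
    this gives uncorrelatedness. *)
Lemma integral_mul_indices (g : 'I_m -> R) k l : k != l ->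
  (\int[P]_w (g (X k w) * g (X l w))%:E = ((\sum_i p i * g i) ^+ 2)%:E)%E.
Proof.
move=> kl; pose A (ij : 'I_m * 'I_m) := X k @^-1` [set ij.1] `&` X l @^-1` [set ij.2].
have mA ij : measurable (A ij).
  by case: hX => mX _ _; apply: measurableI; exact: mX.
have gE w : (g (X k w) * g (X l w))%:E =
    (\sum_ij (g ij.1 * g ij.2)%:E * (\1_(A ij) w)%:E)%E.
  rewrite (bigD1 (X k w, X l w))//= big1 ?adde0.
    by rewrite indicE mem_set// mule1.
  move=> [i j] /= ij; rewrite indicE memNset ?mule0//= => -[/= wi wj].
  by move: ij; rewrite wi wj eqxx.
have iA ij : P.-integrable setT (EFin \o (\1_(A ij) : T -> R)).
  exact: integrable_indic.
under eq_integral do rewrite gE.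
rewrite integral_sum//; first last.
  by move=> ij; apply: (integrableZl measurableT _ (iA ij)).
under eq_bigr => ij _.
  rewrite (integralZl measurableT (iA ij)) integral_indic// setIT.
  rewrite /A/= probability_two_indices//.
  over.
rewrite sumEFin expr2 big_distrlr/= pair_big; congr EFin.
by apply: eq_bigr => ij _; rewrite /=; ring.
Qed.

Lemma strong_law_centred (g : 'I_m -> R) : \sum_i p i * g i = 0 ->
  {ae P, forall w, (\sum_(k < n) g (X k w)) / n%:R @[n --> \oo] --> 0}.
Proof.
(* As [g] has finitely many values, the sum of their absolute values is a uniform bound. *)
move=> g0; apply: (@strong_law_uncorrelated _ _ _ _ (fun k w => g (X k w))
    (\sum_i `|g i|)).
- by move=> k; exact: measurable_comp_index.
- by move=> k w; rewrite (bigD1 (X k w))//= lerDl sumr_ge0.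
- by move=> k l kl; rewrite integral_mul_indices// g0 expr0n.
Qed.

End IidIndices.

(** An almost-everywhere statement only places the complement inside a null set; measurability of
    [A] turns this into an exact probability. *)
Lemma probability_ae1 d (T : measurableType d) (R : realType)
    (P : probability T R) (A : set T) :
  measurable A -> {ae P, forall w, A w} -> P A = 1%E.
Proof.
move=> mA aeA; have PCA : P (~` A) = 0%E.
  by apply: measure_negligible => //; exact: measurableC.
by rewrite -[A]setCK probability_setC; [rewrite /= PCA sube0|exact: measurableC].
Qed.

(** * Almost sure convergence of the random spectral radius *)

Theorem theorem1 (R : realType) (d m : nat)
    (lambda : 'I_m -> 'I_d.+1 -> R[i]) (D : 'I_m -> 'M[R[i]]_d.+1)
    (hD : forall i : 'I_m, D i = diag_mx (\row_r lambda i r))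
    (hlambda : forall (i : 'I_m) (r : 'I_d.+1), lambda i r != 0)
    (hdom : forall (i : 'I_m) (r : 'I_d.+1), r != ord0 ->
       modulus (lambda i r) < modulus (lambda i ord0))
    (p : 'I_m -> R)
    (p_ge0 : forall i : 'I_m, 0 <= p i)
    (p_sum1 : \sum_(i < m) p i = 1)
    (disp : measure_display) (T : measurableType disp) (P : probability T R)
    (X : nat -> T -> 'I_m)
    (hX : iid_indices P p X) :
  let limit_event := [set w : T |
    (fun n : nat => random_spectral_radius D X n w) @ \oo -->
      \prod_(i < m) (modulus (lambda i ord0) `^ p i)] in
  measurable limit_event /\ P limit_event = 1%E.
Proof.
move=> limit_event.
have rhoE n w : random_spectral_radius D X n w =
    (\prod_(k < n) modulus (lambda (X k w) ord0)) `^ n%:R^-1.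
  have -> : D = fun i => diag_mx (\row_r lambda i r) by exact/funext.
  apply: random_spectral_radius_diag_mx => i r.
  by have [->//|/hdom/ltW->] := eqVneq r ord0.
have mlim : measurable limit_event.
  apply: measurable_cvgr => n; rewrite (funext (rhoE n)).
  apply: (measurableT_comp (measurable_powR _)).
  apply: measurable_prod => k _.
  exact: (measurable_comp_index _ _ _ _ _ _ _ hX
            (fun i => modulus (lambda i ord0))).
split=> //; apply: probability_ae1 => //.
(* Positivity makes [expR] undo [ln] on these moduli. *)
have l0 i : 0 < modulus (lambda i ord0) by exact/modulus_gt0/hlambda.
pose L i := ln (modulus (lambda i ord0)).
(* [mu] is the expectation of [L (X k w)] and the logarithm of the claimed limit; subtracting it
   centres the variables. *)
pose mu := \sum_i p i * L i.
have g0 : \sum_i p i * (L i - mu) = 0.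
  under eq_bigr do rewrite mulrBr.
  by rewrite sumrB -mulr_suml p_sum1 mul1r subrr.
apply: filterS (strong_law_centred _ _ _ _ _ _ _ hX _ g0) => w mean0.
rewrite /limit_event/= prod_expR_ln//.
under eq_bigr do rewrite mulrC.
have : expR ((\sum_(k < n) (L (X k w) - mu)) / n%:R + mu) @[n --> \oo] -->
    expR (0 + mu).
  apply: continuous_cvg; first exact: continuous_expR.
  by apply: cvgD => //; exact: cvg_cst.
rewrite add0r; apply: cvg_trans; apply: near_eq_cvg.
(* For [n >= 1] the total [mu * n] divided by [n] is [mu], so the recentred exponent is the
   logarithm of the random spectral radius. *)
exists 1%N => // n /= n0.
rewrite rhoE sumrB sumr_const card_ord -(mulr_natr mu) mulrBl mulfK ?subrK; last first.
  by rewrite pnatr_eq0 -lt0n.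
rewrite /powR gt_eqF ?prodr_gt0// mulrC; congr (expR (_ * _)).
(* Each modulus is written as a power with exponent 1 to match the form of [prod_expR_ln]. *)
under [in RHS]eq_bigr do rewrite -[modulus _]powRr1 ?ltW//.
by rewrite prod_expR_ln// expRK; apply: eq_bigr => k _; rewrite mulr1.
Qed.
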